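(* Let $\theta$ be an irrational real number, $\phi(z)=e^{2\pi i\theta}z$, and let $\psi(z)=\sum_{k=0}^\infty\hat\psi_kz^k$ be analytic on $\mathbb{D}$ such that $C_{\psi,\phi}$ is a bounded operator on $\mathcal{D}$. Let $r\ge0$ and $s>0$ be integers. Then $W(C_{\psi,\phi})$ contains an elliptical disk whose foci are $\hat\psi_0e^{2\pi ir\theta}$ and $\hat\psi_0e^{2\pi i(r+s)\theta}$, and whose major and minor axes have lengths $$\sqrt{|\hat\psi_0|^2\left|e^{2\pi ir\theta}-e^{2\pi i(r+s)\theta}\right|^2+\frac{r+s+1}{r+1}|\hat\psi_s|^2}\quad\text{and}\quad\sqrt{\frac{r+s+1}{r+1}}\,|\hat\psi_s|$$ respectively.
   Context: $\mathbb{D}=\{z\in\mathbb{C}:|z|<1\}$. The Dirichlet space $\mathcal{D}$ is the Hilbert space of all holomorphic $f(z)=\sum_{n\ge0}\hat f_nz^n$ on $\mathbb{D}$ with $\sum_{n\ge 0}(n+1)|\hat f_n|^2<\infty$ (equivalently $\int_{\mathbb{D}}|f'|^2dA<\infty$), with inner product $\langle f,g\rangle_{\mathcal{D}}=\sum_{n\ge0}(n+1)\hat f_n\overline{\hat g_n}$. The weighted composition operator is $(C_{\psi,\phi}f)(z)=\psi(z)f(\phi(z))$. The numerical range of a bounded operator $T$ on a Hilbert space $\mathcal{H}$ is $W(T)=\{\langle Tf,f\rangle:f\in\mathcal{H},\|f\|=1\}$. The elliptical disk with foci $a,b\in\mathbb{C}$ and major axis of (full) length $L$ is $\{z\in\mathbb{C}:|z-a|+|z-b|\le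 L\}$ (degenerating to the segment $[a,b]$ if the minor axis has length $0$). *)

(* Defs.v *)
From Stdlib Require Import Reals QArith Qreals ClassicalEpsilon.
From Coquelicot Require Import Coquelicot.

Open Scope R_scope.

Definition irrational (x : R) : Prop := ~ exists q : Q, x = Q2R q.

(** e^{i t} *)
Definition expi (t : R) : C := (cos t, sin t).

(** Functions on the unit disk are total functions [C -> C] whose values
    outside the disk are never inspected. *)
Definition in_disk (z : C) : Prop := Cmod z < 1.

Definition power_series_on_disk (f : C -> C) (a : nat -> C) : Prop :=
  forall z : C, in_disk z ->
    is_pseries (K := C_AbsRing) (V := C_NormedModule) a z (f z).

Definition analytic_on_disk (f : C -> C) : Prop :=
  exists a : nat -> C, power_series_on_disk f a.

(** The coefficient sequence of [f], which is unique when [f] is analytic on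
    the disk (and unspecified otherwise). *)
Definition coeff (f : C -> C) : nat -> C :=
  epsilon (inhabits (fun _ : nat => RtoC 0)) (power_series_on_disk f).

(** Coquelicot's [Series] is real-valued; complex series are summed
    componentwise. *)
Definition CSeries (a : nat -> C) : C :=
  (Series (fun n => Re (a n)), Series (fun n => Im (a n))).

Definition dirichlet (f : C -> C) : Prop :=
  analytic_on_disk f /\
  ex_series (fun n => INR (n + 1) * Cmod (coeff f n) ^ 2).

Definition dirichlet_inner (f g : C -> C) : C :=
  CSeries (fun n => (INR (n + 1) * coeff f n * Cconj (coeff g n))%C).

Definition dirichlet_norm (f : C -> C) : R := sqrt (Re (dirichlet_inner f f)).

Definition wcomp (psi phi : C -> C) (f : C -> C) : C -> C :=
  fun z => (psi z * f (phi z))%C.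

(** Linearity is not included: it is automatic for [wcomp psi phi]. *)
Definition dirichlet_bounded (T : (C -> C) -> (C -> C)) : Prop :=
  (forall f, dirichlet f -> dirichlet (T f)) /\
  exists M : R, forall f, dirichlet f ->
    dirichlet_norm (T f) <= M * dirichlet_norm f.

Definition numerical_range (T : (C -> C) -> (C -> C)) (w : C) : Prop :=
  exists f : C -> C,
    dirichlet f /\ dirichlet_norm f = 1 /\ w = dirichlet_inner (T f) f.

Definition elliptical_disk (a b : C) (L : R) (z : C) : Prop :=
  Cmod (z - a) + Cmod (z - b) <= L.

(** The minor axis is the chord of the disk along the perpendicular bisector
    of the foci. Its length is expressed as the diameter of the set of points
    of the disk equidistant from the foci, which also covers [a = b] (all of
    the round disk) and the degenerate segment (its midpoint alone). *)
Definition has_minor_axis_length (a b : C) (L l : R) : Prop :=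
  let on_axis z :=
    elliptical_disk a b L z /\ Cmod (z - a) = Cmod (z - b) in
  (exists z w : C, on_axis z /\ on_axis w /\ Cmod (z - w) = l) /\
  (forall z w : C, on_axis z -> on_axis w -> Cmod (z - w) <= l).

(* Main.v *)
Require Import Defs.
From Stdlib Require Import Reals Lra Lia ClassicalEpsilon.
From Coquelicot Require Import Coquelicot.

(** Write [e_n = z^n / sqrt (n + 1)] for the standard orthonormal basis of the
    Dirichlet space, [T = wcomp psi phi], [lam = expi (2 * PI * theta)] and
    [p = r + s]. The numerical range of [T] contains that of any of its
    compressions; the one to the span of [e_r] and [e_p] already suffices.
    Since [T z^n = psi * lam^n z^n] has no coefficient below [n], the
    compression is lower triangular: its diagonal is
    [a = psihat_0 lam^r], [b = psihat_0 lam^p], and its off-diagonal entry is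
    [c = sqrt ((p + 1) / (r + 1)) * psihat_s * lam^r]. In terms of forms, for
    [f = al e_r + be e_p] of norm [1],
    [<T f, f> = a |al|^2 + b |be|^2 + c al (Cconj be)]
    ([numerical_range_wcomp_rotation]).

    By the elliptical range theorem for 2 x 2 matrices
    ([elliptical_range_2x2]), these values fill the elliptical disk with foci
    [a], [b] and minor axis [|c|]. Here is why. The point
    [u = |al|^2 - |be|^2], [v = 2 al (Cconj be)] runs over the whole unit sphere
    [u^2 + |v|^2 = 1] of [R * C], and the form is the affine function
    [(a + b) / 2 + u d + c v / 2] of it, where [d = (a - b) / 2]. To hit
    [(a + b) / 2 + m], solve for [v] (if [c <> 0]) and substitute into the
    equation of the sphere: what remains is a quadratic equation in [u], whose
    discriminant factors as in Heron's formula and is nonnegative on the disk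
    ([ellipse_quadratic]).

    Inner products are read off power series coefficients, which are unique
    ([coeff_eq]); all those needed have at most two nonzero terms. *)

Open Scope R_scope.

(** * The elliptical range theorem for triangular 2 x 2 matrices *)

Lemma RtoC_neq_0 (x : R) : x <> 0 -> RtoC x <> 0.
Proof. intros H E. apply H. now apply RtoC_inj. Qed.

Lemma Cconj_RtoC (x : R) : Cconj (RtoC x) = RtoC x.
Proof. unfold Cconj, RtoC; simpl. now rewrite Ropp_0. Qed.

(** [P] and [Q] are the distances from [m] to the foci [d] and [-d], and [L],
    [l] are the axes. With [k = Q^2 - P^2 = 4 <m, d>], the equation is
    [L^2 u^2 - 2 k u + 2 (P^2 + Q^2) - L^2 = 0]. A quarter of its discriminant is
    [k^2 - 2 L^2 (P^2 + Q^2) + L^4 = (L^2 - (P + Q)^2) (L^2 - (P - Q)^2)], so it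
    has real roots if [L > 0]. The quadratic equals [4 P^2] at [1] and [4 Q^2] at [-1], and
    its vertex [k / L^2] lies in [[-1, 1]], so the roots lie there too. *)
Lemma ellipse_quadratic (d1 d2 m1 m2 l L P Q : R) :
  0 <= P -> 0 <= Q ->
  P ^ 2 = (m1 - d1) ^ 2 + (m2 - d2) ^ 2 ->
  Q ^ 2 = (m1 + d1) ^ 2 + (m2 + d2) ^ 2 ->
  L ^ 2 = 4 * (d1 ^ 2 + d2 ^ 2) + l ^ 2 ->
  P + Q <= L ->
  exists u, -1 <= u <= 1 /\
    4 * ((m1 - u * d1) ^ 2 + (m2 - u * d2) ^ 2) = l ^ 2 * (1 - u ^ 2).
Proof.
  intros HP HQ EP EQ EL H.
  destruct (Req_dec L 0) as [L0 | L0].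
  - exists 0; split; [lra |].
    assert (P0 : P = 0) by lra. assert (Q0 : Q = 0) by lra.
    subst L P Q. nra.
  - assert (L2 : 0 < L ^ 2) by nra.
    set (k := Q ^ 2 - P ^ 2).
    set (D := (L ^ 2 - (P + Q) ^ 2) * (L ^ 2 - (P - Q) ^ 2)).
    assert (D0 : 0 <= D) by (apply Rmult_le_pos; nra).
    assert (SD : sqrt D ^ 2 = D) by (apply pow2_sqrt; exact D0).
    assert (K : Rabs k <= L ^ 2) by (apply Rabs_le; unfold k; nra).
    apply Rabs_le_between in K.
    (* The larger root is at most 1, because the quadratic is 4 P^2 >= 0 there. *)
    assert (SDle : sqrt D <= L ^ 2 - k).
    { rewrite <- (sqrt_pow2 (L ^ 2 - k)) by lra.
      apply sqrt_le_1_alt. unfold D, k.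
      assert (0 <= L ^ 2 * (4 * P ^ 2)) by (apply Rmult_le_pos; nra). nra. }
    pose proof (sqrt_pos D) as SD0.
    exists ((k + sqrt D) / L ^ 2).
    set (u := (k + sqrt D) / L ^ 2).
    assert (U : u * L ^ 2 = k + sqrt D) by (unfold u; field; lra).
    split; [split; nra |].
    assert (E : L ^ 2 * (L ^ 2 * u ^ 2 - 2 * k * u + 2 * (P ^ 2 + Q ^ 2) - L ^ 2) = 0).
    { replace (sqrt D) with (u * L ^ 2 - k) in SD by lra. unfold D in SD.
      unfold k in *. nra. }
    apply Rmult_integral in E. destruct E as [E | E]; [lra |].
    unfold k in E. nra.
Qed.

(** The Hopf map from unit vectors of [C^2] to the unit sphere of [R * C] is
    onto. Taking [al] to be a nonnegative real number forces [be], except at the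
    pole [u = -1], where [al = 0]. *)
Lemma bloch_sphere_state (u : R) (v : C) :
  Cmod v ^ 2 = 1 - u ^ 2 -> -1 <= u <= 1 ->
  exists al be : C,
    Cmod al ^ 2 = (1 + u) / 2 /\ Cmod be ^ 2 = (1 - u) / 2 /\
    (al * Cconj be)%C = (v / 2)%C.
Proof.
  intros Hv Hu.
  destruct (Req_dec u (-1)) as [U | U].
  - exists (RtoC 0), (RtoC 1). rewrite Cmod_0, Cmod_1.
    assert (v = RtoC 0) as -> by (apply Cmod_eq_0; subst u; nra).
    repeat split; try lra. rewrite Cmult_0_l. unfold Cdiv. ring.
  - set (h := sqrt ((1 + u) / 2)).
    assert (h0 : 0 < h) by (apply sqrt_lt_R0; lra).
    assert (hh : h ^ 2 = (1 + u) / 2) by (apply pow2_sqrt; lra).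
    exists (RtoC h), (Cconj v / (2 * h))%C.
    assert (hC : RtoC h <> 0) by (apply RtoC_neq_0; lra).
    assert (h2 : (2 * RtoC h)%C <> 0)
      by (rewrite <- RtoC_mult; apply RtoC_neq_0; lra).
    split; [| split].
    + rewrite Cmod_R, pow2_abs; exact hh.
    + rewrite Cmod_div by exact h2.
      rewrite Cmod_conj, Cmod_mult, !Cmod_R, (Rabs_right 2), (Rabs_right h) by lra.
      replace ((Cmod v / (2 * h)) ^ 2) with (Cmod v ^ 2 / (4 * h ^ 2)) by (field; lra).
      rewrite Hv, hh. field. lra.
    + rewrite Cdiv_conj, Cmult_conj, Cconj_conj by exact h2.
      rewrite !Cconj_RtoC. field. exact hC.
Qed.

(** The right-hand side is the quadratic form of the matrix with rows [(a, 0)]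
    and [(c, b)] at [(al, be)]. The degenerate cases [c = 0] and [a = b] are
    included. *)
Lemma elliptical_range_2x2 (a b c z : C) :
  elliptical_disk a b (sqrt (Cmod (a - b) ^ 2 + Cmod c ^ 2)) z ->
  exists al be : C, Cmod al ^ 2 + Cmod be ^ 2 = 1 /\
    z = (a * Cmod al ^ 2 + b * Cmod be ^ 2 + c * (al * Cconj be))%C.
Proof.
  unfold elliptical_disk. intro H.
  set (d := ((a - b) / 2)%C). set (m := (z - (a + b) / 2)%C).
  assert (Hza : (z - a)%C = (m - d)%C) by (unfold m, d; field; apply RtoC_neq_0; lra).
  assert (Hzb : (z - b)%C = (m + d)%C) by (unfold m, d; field; apply RtoC_neq_0; lra).
  assert (Hab : (a - b)%C = (2 * d)%C) by (unfold d; field; apply RtoC_neq_0; lra).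
  destruct (ellipse_quadratic (Re d) (Im d) (Re m) (Im m) (Cmod c)
              (sqrt (Cmod (a - b) ^ 2 + Cmod c ^ 2)) (Cmod (z - a)) (Cmod (z - b)))
    as (u & Hu & E); auto using Cmod_ge_0.
  - rewrite Hza, Cmod2_alt. destruct m, d; simpl; ring.
  - rewrite Hzb, Cmod2_alt. destruct m, d; simpl; ring.
  - rewrite pow2_sqrt by nra. rewrite Hab, Cmod2_alt. destruct d; simpl; ring.
  - assert (N : Cmod (2 * (m - u * d)) ^ 2 = Cmod c ^ 2 * (1 - u ^ 2)).
    { rewrite <- E, Cmod2_alt. destruct m, d; simpl; ring. }
    assert (exists v : C, (c * v)%C = (2 * (m - u * d))%C /\ Cmod v ^ 2 = 1 - u ^ 2)
      as (v & Ev & Nv).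
    { destruct (Ceq_dec c 0) as [-> | c0].
      - (* The disk is a segment: only the modulus of v is prescribed. *)
        exists (RtoC (sqrt (1 - u ^ 2))). split.
        + rewrite Cmult_0_l. symmetry. apply Cmod_eq_0.
          rewrite Cmod_0 in N. nra.
        + rewrite Cmod_R, pow2_abs. apply pow2_sqrt. nra.
      - exists ((2 * (m - u * d)) / c)%C. split; [field; exact c0 |].
        rewrite Cmod_div by exact c0.
        apply Cmod_gt_0 in c0.
        replace ((Cmod (2 * (m - u * d)) / Cmod c) ^ 2)
          with (Cmod (2 * (m - u * d)) ^ 2 / Cmod c ^ 2) by (field; lra).
        rewrite N. field. lra. }
    destruct (bloch_sphere_state u v Nv Hu) as (al & be & Na & Nb & X).
    exists al, be. split; [lra |].
    rewrite X, <- !RtoC_pow, Na, Nb.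
    replace (c * (v / 2))%C with (m - u * d)%C.
    2: { replace (c * (v / 2))%C with (c * v / 2)%C
           by (field; apply RtoC_neq_0; lra).
         rewrite Ev. field. }
    rewrite !RtoC_div by lra. rewrite RtoC_plus, RtoC_minus.
    unfold m, d. field.
Qed.

(** * The minor axis of an ellipse *)

Lemma unit_normal (d : C) : exists n : C,
  Cmod n = 1 /\ Re n * Re d + Im n * Im d = 0.
Proof.
  destruct (Ceq_dec d 0) as [-> | d0].
  - exists (RtoC 1). rewrite Cmod_1. simpl. split; ring.
  - exists (Ci * d / Cmod d)%C.
    pose proof (proj1 (Cmod_gt_0 d) d0) as p.
    assert (RtoC (Cmod d) <> 0) by (apply RtoC_neq_0; lra).
    split.
    + rewrite Cmod_div, Cmod_mult, Cmod_R, Rabs_right by (lra || assumption).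
      replace (Cmod Ci) with 1.
      * field; lra.
      * unfold Cmod, Ci; simpl. rewrite <- sqrt_1 at 1. f_equal. ring.
    + destruct d as [x y]. simpl in *. field. exact (Rgt_not_eq _ _ p).
Qed.

(** A point equidistant from the foci lies in the disk when both distances are
    at most [L / 2]; by Pythagoras this means that it is within [l / 2] of the
    centre. The extreme points are found along a unit normal to [a - b], which
    may be any unit vector if [a = b]. *)
Lemma ellipse_minor_axis (a b : C) (l : R) : 0 <= l ->
  has_minor_axis_length a b (sqrt (Cmod (a - b) ^ 2 + l ^ 2)) l.
Proof.
  intro l0. unfold has_minor_axis_length, elliptical_disk.
  set (L := sqrt (Cmod (a - b) ^ 2 + l ^ 2)).
  assert (L2 : L ^ 2 = Cmod (a - b) ^ 2 + l ^ 2) by (apply pow2_sqrt; nra).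
  assert (L0 : 0 <= L) by apply sqrt_pos.
  set (c := ((a + b) / 2)%C).
  split.
  - destruct (unit_normal (a - b)%C) as (n & n1 & np).
    assert (nn : Re n ^ 2 + Im n ^ 2 = 1) by (rewrite <- Cmod2_alt, n1; ring).
    assert (on : forall t : R, t ^ 2 = l ^ 2 / 4 ->
      let z := (c + t * n)%C in
      Cmod (z - a) = L / 2 /\ Cmod (z - b) = L / 2).
    { intros t Ht z.
      assert (T : t ^ 2 * (Re n ^ 2 + Im n ^ 2) = l ^ 2 / 4) by (rewrite nn; lra).
      assert (T' : t * (Re n * Re (a - b) + Im n * Im (a - b)) = 0) by (rewrite np; ring).
      rewrite Cmod2_alt in L2.
      split; apply Rsqr_inj; try apply Cmod_ge_0; try lra;
        rewrite !Rsqr_pow2, Cmod2_alt; unfold z, c; destruct a, b, n; simpl in *; nra. }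
    exists (c + (l / 2)%R * n)%C, (c + (- (l / 2))%R * n)%C.
    destruct (on (l / 2)) as [A1 A2]; [lra |].
    destruct (on (- (l / 2))) as [B1 B2]; [lra |].
    rewrite A1, A2, B1, B2. repeat split; try lra.
    replace (c + (l / 2)%R * n - (c + (- (l / 2))%R * n))%C with (RtoC l * n)%C.
    2: { rewrite RtoC_opp, RtoC_div by lra. field. }
    rewrite Cmod_mult, n1, Cmod_R, Rabs_right by lra. ring.
  - assert (near : forall z, Cmod (z - a) + Cmod (z - b) <= L /\
                             Cmod (z - a) = Cmod (z - b) -> Cmod (z - c) <= l / 2).
    { intros z [H1 H2].
      apply Rsqr_incr_0_var; [| lra].
      rewrite !Rsqr_pow2.
      assert (Cmod (z - a) ^ 2 + Cmod (z - b) ^ 2 <= L ^ 2 / 2).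
      { rewrite <- H2. pose proof (Cmod_ge_0 (z - a)%C). nra. }
      rewrite L2, !Cmod2_alt in H. rewrite Cmod2_alt.
      unfold c; destruct a, b, z; simpl in *; nra. }
    intros z w Hz Hw. apply near in Hz. apply near in Hw.
    replace (z - w)%C with ((z - c) + - (w - c))%C by ring.
    eapply Rle_trans; [apply Cmod_triangle |]. rewrite Cmod_opp. lra.
Qed.

(** * Uniqueness of power series coefficients *)

Lemma is_series_Re_Im (u : nat -> C) (l : C) :
  is_series (K := C_AbsRing) (V := C_NormedModule) u l ->
  is_series (fun n => Re (u n)) (Re l) /\ is_series (fun n => Im (u n)) (Im l).
Proof.
  intro H.
  assert (S : forall n, sum_n (G := C_NormedModule) u n =
              (sum_n (fun k => Re (u k)) n, sum_n (fun k => Im (u k)) n)).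
  { induction n as [| n IH].
    - rewrite !sum_O. apply surjective_pairing.
    - rewrite !sum_Sn, IH. reflexivity. }
  split.
  - apply filterlim_ext with (fun n => fst (sum_n (G := C_NormedModule) u n)).
    { intro n. now rewrite S. }
    eapply filterlim_comp; [exact H |]. destruct l. apply continuous_fst.
  - apply filterlim_ext with (fun n => snd (sum_n (G := C_NormedModule) u n)).
    { intro n. now rewrite S. }
    eapply filterlim_comp; [exact H |]. destruct l. apply continuous_snd.
Qed.

Lemma pow_n_RtoC (x : R) (n : nat) : pow_n (K := C_AbsRing) (RtoC x) n = RtoC (x ^ n).
Proof.
  induction n as [| n IH]; [reflexivity |].
  simpl. rewrite IH, RtoC_mult. reflexivity.
Qed.

Lemma power_series_on_real_axis (f : C -> C) (a : nat -> C) (x : R) :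
  power_series_on_disk f a -> Rabs x < 1 ->
  is_pseries (fun n => Re (a n)) x (Re (f x)) /\
  is_pseries (fun n => Im (a n)) x (Im (f x)).
Proof.
  intros H Hx.
  assert (Hd : in_disk x) by (unfold in_disk; now rewrite Cmod_R).
  apply H, is_series_Re_Im in Hd. destruct Hd as [H1 H2].
  split; [revert H1 | revert H2]; apply is_series_ext; intro n;
    rewrite pow_n_RtoC.
  - rewrite (pow_n_pow x n : pow_n (K := R_AbsRing) x n = x ^ n).
    change (x ^ n * Re (a n) - 0 * Im (a n) = x ^ n * Re (a n)). ring.
  - rewrite (pow_n_pow x n : pow_n (K := R_AbsRing) x n = x ^ n).
    change (x ^ n * Im (a n) + 0 * Re (a n) = x ^ n * Im (a n)). ring.
Qed.

(** If the radius were [0], the terms of the series at [1 / 2] could not tend to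
    [0]. *)
Lemma CV_radius_pos_of_interval (a : nat -> R) :
  (forall x, Rabs x < 1 -> ex_pseries a x) -> Rbar_lt 0 (CV_radius a).
Proof.
  intro H. destruct (Rbar_lt_le_dec 0 (CV_radius a)) as [| N]; [assumption |].
  exfalso. apply (CV_disk_outside a (1 / 2)).
  - eapply Rbar_le_lt_trans; [exact N |]. simpl. rewrite Rabs_right; lra.
  - apply ex_series_lim_0.
    apply ex_series_ext with (2 := H (1 / 2) ltac:(rewrite Rabs_right; lra)).
    intro n. rewrite (pow_n_pow _ n : pow_n (K := R_AbsRing) (1 / 2) n = _). apply Rmult_comm.
Qed.

Lemma real_coefficients_unique (a b : nat -> R) (g : R -> R) :
  (forall x, Rabs x < 1 -> is_pseries a x (g x)) ->
  (forall x, Rabs x < 1 -> is_pseries b x (g x)) -> forall n, a n = b n.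
Proof.
  intros Ha Hb n. apply PSeries_ext_recip.
  - apply CV_radius_pos_of_interval. intros x Hx. exists (g x). now apply Ha.
  - apply CV_radius_pos_of_interval. intros x Hx. exists (g x). now apply Hb.
  - exists (mkposreal 1 Rlt_0_1). intros x Hx.
    assert (Hx' : Rabs x < 1).
    { revert Hx. cbv [ball]; simpl. cbv [AbsRing_ball abs minus plus opp]; simpl.
      now rewrite Ropp_0, Rplus_0_r. }
    rewrite (is_pseries_unique _ _ _ (Ha x Hx')).
    now rewrite (is_pseries_unique _ _ _ (Hb x Hx')).
Qed.

(** On the real axis the real and imaginary parts of a complex power series are
    real power series, so uniqueness follows from the real case. *)
Lemma coeff_eq (f : C -> C) (a : nat -> C) :
  power_series_on_disk f a -> forall n, coeff f n = a n.
Proof.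
  intros Ha n.
  assert (Hc : power_series_on_disk f (coeff f))
    by (unfold coeff; apply epsilon_spec; now exists a).
  assert (Re (coeff f n) = Re (a n)).
  { apply (real_coefficients_unique (fun n => Re (coeff f n))
             (fun n => Re (a n)) (fun x => Re (f x)));
      intros x Hx; now apply power_series_on_real_axis. }
  assert (Im (coeff f n) = Im (a n)).
  { apply (real_coefficients_unique (fun n => Im (coeff f n))
             (fun n => Im (a n)) (fun x => Im (f x)));
      intros x Hx; now apply power_series_on_real_axis. }
  destruct (coeff f n), (a n); simpl in *; congruence.
Qed.

(** * Series with two nonzero terms *)

Lemma is_series_single (u : nat -> R) (p : nat) :
  (forall n, n <> p -> u n = 0) -> is_series u (u p).
Proof.
  intro H.
  assert (S : forall n, sum_n u n = if Compare_dec.le_lt_dec p n then u p else 0).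
  { induction n as [| n IH].
    - rewrite sum_O. destruct Compare_dec.le_lt_dec.
      + now replace p with 0%nat by lia.
      + apply H. lia.
    - rewrite sum_Sn, IH. cbv [plus]; simpl.
      destruct (Nat.eq_dec (S n) p) as [<- | N].
      + destruct Compare_dec.le_lt_dec; [lia |].
        destruct Compare_dec.le_lt_dec; [| lia]. ring.
      + rewrite (H (S n) N).
        destruct Compare_dec.le_lt_dec; destruct Compare_dec.le_lt_dec; try lia; ring. }
  apply filterlim_ext_loc with (fun _ => u p); [| apply filterlim_const].
  exists p. intros n Hn. rewrite S. now destruct Compare_dec.le_lt_dec; [| lia].
Qed.

Lemma is_series_two_terms (u : nat -> R) (p q : nat) : p <> q ->
  (forall n, n <> p -> n <> q -> u n = 0) -> is_series u (u p + u q).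
Proof.
  intros pq H.
  set (only := fun i n => if Nat.eq_dec n i then u n else 0).
  assert (O : forall i, is_series (only i) (u i)).
  { intro i. replace (u i) with (only i i).
    - apply is_series_single. intros n N. unfold only. now destruct Nat.eq_dec.
    - unfold only. now destruct Nat.eq_dec. }
  generalize (is_series_plus _ _ _ _ (O p) (O q)). apply is_series_ext.
  intro n. unfold only. cbv [plus]; simpl.
  destruct (Nat.eq_dec n p), (Nat.eq_dec n q); subst; try contradiction; try ring.
  rewrite H by assumption. ring.
Qed.

Lemma CSeries_two_terms (u : nat -> C) (p q : nat) : p <> q ->
  (forall n, n <> p -> n <> q -> u n = 0) -> CSeries u = (u p + u q)%C.
Proof.
  intros pq H. unfold CSeries.
  rewrite (is_series_unique _ _ (is_series_two_terms (fun n => Re (u n)) p q pq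
    ltac:(intros n ? ?; simpl; now rewrite H))).
  rewrite (is_series_unique _ _ (is_series_two_terms (fun n => Im (u n)) p q pq
    ltac:(intros n ? ?; simpl; now rewrite H))).
  reflexivity.
Qed.

(** * Products with binomials *)

Definition binomial (r p : nat) (x y : C) (z : C) : C := (x * z ^ r + y * z ^ p)%C.

Definition binomial_coeffs (a : nat -> C) (r p : nat) (x y : C) (n : nat) : C :=
  (x * (if Compare_dec.le_lt_dec r n then a (n - r)%nat else 0) +
   y * (if Compare_dec.le_lt_dec p n then a (n - p)%nat else 0))%C.

Lemma power_series_mult_binomial (g : C -> C) (a : nat -> C) (r p : nat) (x y : C) :
  power_series_on_disk g a ->
  power_series_on_disk (fun z => g z * binomial r p x y z)%C
    (binomial_coeffs a r p x y).
Proof.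
  intros H z Hz. specialize (H z Hz).
  assert (P : forall k, pow_n (K := C_AbsRing) z k = (z ^ k)%C).
  { induction k as [| k IH]; [reflexivity |]. simpl. now rewrite IH. }
  assert (M : forall c k, is_pseries (K := C_AbsRing) (V := C_NormedModule)
            (PS_scal c (PS_incr_n a k)) z (c * (z ^ k * g z))%C).
  { intros c k. rewrite <- P. apply (is_pseries_scal (K := C_AbsRing) (V := C_NormedModule) c).
    - apply Cmult_comm.
    - exact (is_pseries_incr_n (K := C_AbsRing) (V := C_NormedModule) a k z _ H). }
  unfold binomial.
  replace (g z * (x * z ^ r + y * z ^ p))%C
    with (x * (z ^ r * g z) + y * (z ^ p * g z))%C by ring.
  generalize (is_pseries_plus _ _ _ _ _ (M x r) (M y p)).
  apply is_series_ext. intro n. unfold PS_plus, PS_scal.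
  now rewrite !PS_incr_n_simplify.
Qed.

Lemma power_series_one :
  power_series_on_disk (fun _ => 1)%C (fun n => if Nat.eq_dec n 0 then 1 else 0)%C.
Proof.
  intros z _.
  apply filterlim_ext with (fun _ => RtoC 1); [| apply filterlim_const].
  induction x as [| n IH].
  - rewrite sum_O. symmetry. apply Cmult_1_l.
  - rewrite sum_Sn, <- IH. simpl.
    change (RtoC 1 = RtoC 1 + (z * pow_n (K := C_AbsRing) z n) * 0)%C. ring.
Qed.

Lemma power_series_binomial (r p : nat) (x y : C) :
  power_series_on_disk (binomial r p x y)
    (fun n => x * (if Nat.eq_dec n r then 1 else 0) +
              y * (if Nat.eq_dec n p then 1 else 0))%C.
Proof.
  intros z Hz.
  generalize (power_series_mult_binomial _ _ r p x y power_series_one z Hz).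
  rewrite Cmult_1_l. apply is_series_ext. intro n. f_equal.
  unfold binomial_coeffs. f_equal; f_equal.
  - destruct Compare_dec.le_lt_dec; repeat destruct Nat.eq_dec; lia || reflexivity.
  - destruct Compare_dec.le_lt_dec; repeat destruct Nat.eq_dec; lia || reflexivity.
Qed.

(** * Binomials in the Dirichlet space *)

Lemma dirichlet_inner_binomial (g : C -> C) (b : nat -> C) (r p : nat) (x y : C) :
  r <> p -> power_series_on_disk g b ->
  dirichlet_inner g (binomial r p x y) =
  (INR (r + 1) * b r * Cconj x + INR (p + 1) * b p * Cconj y)%C.
Proof.
  intros rp Hb. unfold dirichlet_inner.
  rewrite (CSeries_two_terms _ r p rp); intros;
    rewrite ?(coeff_eq _ _ Hb), ?(coeff_eq _ _ (power_series_binomial r p x y)).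
  - repeat (destruct Nat.eq_dec; try contradiction; try congruence).
    f_equal; do 2 f_equal; ring.
  - repeat (destruct Nat.eq_dec; try contradiction).
    replace (x * 0 + y * 0)%C with (RtoC 0) by ring.
    rewrite Cconj_RtoC. apply Cmult_0_r.
Qed.

Lemma dirichlet_binomial (r p : nat) (x y : C) :
  r <> p -> dirichlet (binomial r p x y).
Proof.
  intro rp. split.
  - eexists. apply power_series_binomial.
  - eexists. apply (is_series_two_terms _ r p rp). intros n nr np.
    rewrite (coeff_eq _ _ (power_series_binomial r p x y)).
    repeat (destruct Nat.eq_dec; try contradiction).
    rewrite !Cmult_0_r, Cplus_0_r, Cmod_0. ring.
Qed.

Lemma dirichlet_norm_binomial (r p : nat) (x y : C) : r <> p ->
  dirichlet_norm (binomial r p x y) =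
  sqrt (INR (r + 1) * Cmod x ^ 2 + INR (p + 1) * Cmod y ^ 2).
Proof.
  intro rp. unfold dirichlet_norm. f_equal.
  rewrite (dirichlet_inner_binomial _ _ r p x y rp (power_series_binomial r p x y)).
  repeat (destruct Nat.eq_dec; try contradiction; try congruence).
  rewrite !Cmod2_alt. destruct x, y; simpl. ring.
Qed.

(** * The numerical range *)

(** Composition with [z => lam z] only rescales the two coefficients of a
    binomial. *)
Lemma wcomp_rotation_binomial (lam : C) (phi psi : C -> C) (c : nat -> C)
    (r p : nat) (x y : C) :
  (forall z, phi z = (lam * z)%C) -> power_series_on_disk psi c ->
  power_series_on_disk (wcomp psi phi (binomial r p x y))
    (binomial_coeffs c r p (x * lam ^ r) (y * lam ^ p))%C.
Proof.
  intros Hphi Hpsi z Hz.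
  replace (wcomp psi phi (binomial r p x y) z)
    with (psi z * binomial r p (x * lam ^ r) (y * lam ^ p) z)%C.
  - now apply (power_series_mult_binomial psi c).
  - unfold wcomp, binomial. rewrite Hphi, !Cpow_mult_l. ring.
Qed.

Lemma expi_pow (t : R) (n : nat) : (expi t ^ n)%C = expi (INR n * t).
Proof.
  induction n as [| n IH].
  - unfold expi. simpl. rewrite Rmult_0_l, cos_0, sin_0. reflexivity.
  - rewrite S_INR, Rmult_plus_distr_r, Rmult_1_l, Rplus_comm. simpl. rewrite IH.
    unfold expi. rewrite cos_plus, sin_plus. unfold Cmult; simpl.
    f_equal; ring.
Qed.

Lemma Cmod_expi (t : R) : Cmod (expi t) = 1.
Proof.
  unfold Cmod, expi. simpl. transitivity (sqrt 1); [f_equal | apply sqrt_1].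
  pose proof (sin2_cos2 t). unfold Rsqr in *. lra.
Qed.

(** The value of the form at [al e_r + be e_(r+s)], where
    [e_n = z^n / sqrt (n + 1)]. The coefficients of its image at [r] and [r + s]
    involve only [c 0] and [c s]: the term in [z^(r+s)] contributes nothing at
    [r] because [s > 0]. *)
Lemma numerical_range_wcomp_rotation (lam : C) (phi psi : C -> C) (c : nat -> C)
    (r s : nat) (al be : C) :
  (forall z, phi z = (lam * z)%C) -> power_series_on_disk psi c -> (0 < s)%nat ->
  Cmod al ^ 2 + Cmod be ^ 2 = 1 ->
  numerical_range (wcomp psi phi)
    (c 0%nat * lam ^ r * Cmod al ^ 2 + c 0%nat * lam ^ (r + s) * Cmod be ^ 2 +
     sqrt (INR (r + s + 1) / INR (r + 1)) * c s * lam ^ r * (al * Cconj be))%C.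
Proof.
  intros Hphi Hpsi Hs N.
  set (p := (r + s)%nat). assert (rp : r <> p) by lia.
  set (hr := sqrt (INR (r + 1))). set (hp := sqrt (INR (p + 1))).
  assert (pos : forall n, 0 < INR (n + 1)) by (intro n; apply lt_0_INR; lia).
  assert (hr0 : 0 < hr) by (apply sqrt_lt_R0, pos).
  assert (hp0 : 0 < hp) by (apply sqrt_lt_R0, pos).
  assert (hr2 : INR (r + 1) = hr ^ 2) by (symmetry; apply pow2_sqrt, Rlt_le, pos).
  assert (hp2 : INR (p + 1) = hp ^ 2) by (symmetry; apply pow2_sqrt, Rlt_le, pos).
  assert (hrC : RtoC hr <> 0) by (apply RtoC_neq_0; lra).
  assert (hpC : RtoC hp <> 0) by (apply RtoC_neq_0; lra).
  exists (binomial r p (al / hr) (be / hp)). split; [| split].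
  - now apply dirichlet_binomial.
  - rewrite dirichlet_norm_binomial by exact rp.
    rewrite !Cmod_div, !Cmod_R, !Rabs_right by (lra || assumption).
    transitivity (sqrt 1); [f_equal | apply sqrt_1]. rewrite hr2, hp2, <- N. field. lra.
  - rewrite (dirichlet_inner_binomial _ _ r p _ _ rp
      (wcomp_rotation_binomial lam phi psi c r p (al / hr)%C (be / hp)%C Hphi Hpsi)).
    unfold binomial_coeffs.
    repeat (destruct Compare_dec.le_lt_dec; try lia).
    rewrite !Nat.sub_diag. replace (p - r)%nat with s by lia.
    rewrite sqrt_div_alt by apply pos. fold hr hp.
    rewrite !Cdiv_conj, !Cconj_RtoC by assumption.
    rewrite <- (RtoC_pow (Cmod al)), <- (RtoC_pow (Cmod be)), !Cmod2_conj.
    rewrite hr2, hp2, !RtoC_pow, RtoC_div by lra.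
    field. split; assumption.
Qed.

Theorem theorem4p4 :
  forall (theta : R) (phi psi : C -> C) (psihat : nat -> C) (r s : nat),
  irrational theta ->
  (forall z : C, phi z = (expi (2 * PI * theta) * z)%C) ->
  power_series_on_disk psi psihat ->
  dirichlet_bounded (wcomp psi phi) ->
  (0 < s)%nat ->
  let er := expi (2 * PI * INR r * theta) in
  let ers := expi (2 * PI * INR (r + s) * theta) in
  let a := (psihat 0%nat * er)%C in
  let b := (psihat 0%nat * ers)%C in
  let major :=
    sqrt (Cmod (psihat 0%nat) ^ 2 * Cmod (er - ers) ^ 2
          + INR (r + s + 1) / INR (r + 1) * Cmod (psihat s) ^ 2) in
  let minor := sqrt (INR (r + s + 1) / INR (r + 1)) * Cmod (psihat s) in
  has_minor_axis_length a b major minor /\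
  (forall z : C, elliptical_disk a b major z ->
     numerical_range (wcomp psi phi) z).
Proof.
  intros theta phi psi psihat r s _ Hphi Hpsi _ Hs er ers a b major minor.
  set (lam := expi (2 * PI * theta)) in *.
  assert (Er : er = (lam ^ r)%C) by (unfold lam; rewrite expi_pow; unfold er; f_equal; ring).
  assert (Ers : ers = (lam ^ (r + s))%C)
    by (unfold lam; rewrite expi_pow; unfold ers; f_equal; ring).
  assert (pos : forall n, 0 < INR (n + 1)) by (intro n; apply lt_0_INR; lia).
  assert (q0 : 0 <= INR (r + s + 1) / INR (r + 1))
    by (apply Rlt_le, Rdiv_lt_0_compat; apply pos).
  assert (Hmajor : major = sqrt (Cmod (a - b) ^ 2 + minor ^ 2)).
  { unfold major, minor. f_equal.
    replace (a - b)%C with (psihat 0%nat * (er - ers))%C by (unfold a, b; ring).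
    rewrite Cmod_mult, !Rpow_mult_distr, pow2_sqrt by exact q0. reflexivity. }
  rewrite Hmajor. split.
  - apply ellipse_minor_axis. apply Rmult_le_pos; [apply sqrt_pos | apply Cmod_ge_0].
  - set (c := (sqrt (INR (r + s + 1) / INR (r + 1)) * psihat s * lam ^ r)%C).
    replace minor with (Cmod c).
    + intros z Hz. apply elliptical_range_2x2 in Hz.
      destruct Hz as (al & be & N & ->).
      unfold a, b. rewrite Er, Ers.
      now apply (numerical_range_wcomp_rotation lam).
    + unfold c, minor. rewrite <- Er, !Cmod_mult, Cmod_R, Rabs_right
        by (apply Rle_ge, sqrt_pos).
      unfold er. rewrite Cmod_expi. ring.
Qed.
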